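(* Let $K$ be an infinite field, $S=K[x_1,\ldots,x_n]$, let $I$ be a monomial ideal of $S$ and let $\overline{I}$ be its integral closure. Then: (i) if $I$ is of Borel type, then $\overline{I}$ is a monomial ideal of Borel type; (ii) if $I$ is strongly stable, then $\overline{I}$ is a strongly stable monomial ideal; (iii) if $I$ is Borel-fixed, then $\overline{I}$ is a Borel-fixed monomial ideal; (iv) if $I$ is lexsegment, then $\overline{I}$ is a lexsegment monomial ideal; (v) if $I$ is universal lexsegment, then $\overline{I}$ is a universal lexsegment monomial ideal.
   Context: For a monomial ideal $I$ of $S=K[x_1,\ldots,x_n]$: - $I$ is of Borel type if $I:x_i^{\infty}=I:\langle x_1,\ldots,x_i\rangle^{\infty}$ for every $i=1,\ldots,n$, where $I:L^\infty=\bigcup_{r\ge 1}(I:L^r)$. - $I$ is strongly stable if for every monomial $u\in I$ and all $i<j\le n$ with $x_j\mid u$, one has $x_i(u/x_j)\in I$. - $I$ is Borel-fixed if $\alpha(u)\in I$ for every $u\in I$ and every invertible upper triangular $n\times n$ matrix $\alpha=(\alpha_{ij})$ over $K$, acting on $S$ as the $K$-algebra automorphism $x_j\mapsto\sum_{i\le j}\alpha_{ij}x_i$. - $I$ is lexsegment if for all monomials $u\in I$ and $v\in S$ with $\deg v=\deg u$ and $v>_{lex}u$ (lexicographic order with $x_1>\cdots>x_n$), one has $v\in I$. - $I$ is universal lexsegment if for every $r\ge 0$ the extended ideal $I\,K[x_1,\ldots,x_{n+r}]$ is lexsegment in $K[x_1,\ldots,x_{n+r}]$. The integral closure $\overline{I}$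 is the ideal of all elements of $S$ integral over $I$; for a monomial ideal $I$, it is generated by all monomials $u$ such that $u^k\in I^k$ for some $k>0$. *)

(* Defs.v *)
From HB Require Import structures.
From mathcomp Require Import all_boot all_order all_algebra.
From mathcomp Require Import boolp classical_sets cardinality.
From mathcomp Require Import mpoly.

Set Implicit Arguments.
Unset Strict Implicit.
Unset Printing Implicit Defensive.

Import GRing.Theory.
Local Open Scope classical_set_scope.
Local Open Scope ring_scope.

(* Ideals are Prop-valued sets: the ideals of ring_quotient are proper and    *)
(* decidable, which is too restrictive here.                                  *)

Section Ideals.
Variable R : comNzRingType.
Implicit Types (G I J L : set R).

Definition ideal_gen G : set R :=
  [set f | exists2 s : seq (R * R), (forall p, p \in s -> G p.2)
                                  & f = \sum_(p <- s) p.1 * p.2].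

Definition ideal_mul I J : set R := ideal_gen [set a * b | a in I & b in J].

Definition ideal_exp I (k : nat) : set R := iter k (ideal_mul I) setT.

Definition ideal_colon I J : set R := [set f | forall g, J g -> I (f * g)].

Definition ideal_saturation I L : set R :=
  \bigcup_(r in [set r : nat | (1 <= r)%N]) ideal_colon I (ideal_exp L r).

(* f is integral over I when it satisfies an equation                         *)
(*   f^k + a_1 f^(k-1) + ... + a_k = 0 with k > 0 and a_i in I^i.             *)
Definition integral_closure I : set R :=
  [set f | exists (k : nat) (a : nat -> R),
     [/\ (0 < k)%N,
         forall i, (1 <= i <= k)%N -> ideal_exp I i (a i)
       & f ^+ k + \sum_(1 <= i < k.+1) a i * f ^+ (k - i) = 0]].

End Ideals.

Section MonomialIdeals.
Variables (K : fieldType) (n : nat).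
Implicit Types (I : set {mpoly K[n]}) (u v m : 'X_{1..n}).

Definition monomial_ideal I : Prop :=
  exists M : set 'X_{1..n}, I = ideal_gen [set 'X_[m] | m in M].

(* The variable x_i of the mathematics is 'X_(i-1), since 'I_n starts at 0;   *)
(* hence <x_1, ..., x_i> includes the variable of index i itself.             *)
Definition borel_type I : Prop :=
  forall i : 'I_n,
    ideal_saturation I (ideal_gen [set 'X_i]) =
    ideal_saturation I (ideal_gen [set 'X_j | j in [set j : 'I_n | (j <= i)%N]]).

Definition strongly_stable I : Prop :=
  forall u (i j : 'I_n), I 'X_[u] -> (i < j)%N -> (U_(j) <= u)%MM ->
    I 'X_[(U_(i) + (u - U_(j)))%MM].

(* The K-algebra endomorphism x_j |-> \sum_(i <= j) alpha_ij x_i.             *)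
Definition triangular_act (alpha : 'M[K]_n) (f : {mpoly K[n]}) : {mpoly K[n]} :=
  f \mPo [tuple \sum_(i < n | (i <= j)%N) alpha i j *: 'X_i | j < n].

(* is_trig_mx means lower triangular, so it is applied to the transpose.      *)
Definition borel_fixed I : Prop :=
  forall alpha : 'M[K]_n, alpha \in unitmx -> is_trig_mx alpha^T ->
    forall f, I f -> I (triangular_act alpha f).

(* Lexicographic order with x_1 > ... > x_n; the order that mpoly puts on     *)
(* 'X_{1..n} compares degrees first.                                          *)
Definition lex_gt v u : Prop :=
  exists i : 'I_n, (forall j : 'I_n, (j < i)%N -> v j = u j) /\ (u i < v i)%N.

Definition lexsegment I : Prop :=
  forall u v, I 'X_[u] -> mdeg v = mdeg u -> lex_gt v u -> I 'X_[v].

(* I K[x_1, ..., x_(n+r)], through the inclusion sending x_i to x_i.          *)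
Definition extended_ideal (r : nat) I : set {mpoly K[n + r]} :=
  ideal_gen [set f \mPo [tuple 'X_(lshift r i) | i < n] | f in I].

End MonomialIdeals.

Arguments extended_ideal {K n} r I _.

Definition universal_lexsegment (K : fieldType) (n : nat)
    (I : set {mpoly K[n]}) : Prop :=
  forall r : nat, lexsegment (extended_ideal r I).

(* Main.v *)
From HB Require Import structures.
Require Import Defs.
From mathcomp Require Import all_boot all_order all_algebra.
From mathcomp Require Import boolp classical_sets cardinality.
From mathcomp Require Import mpoly.
From mathcomp Require Import zify.

(* The integral closure is an ideal, since x is integral over I iff x T is    *)
(* integral over the Rees algebra of I, and it is stable under every ring     *)
(* endomorphism that maps I into I. This settles the Borel-fixed case and,    *)
(* applied to the maps x_i |-> t x_i over an infinite field, shows that the   *)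
(* closure of a monomial ideal with exponent set A is monomial, with          *)
(* exponents the u such that k u is a sum of k elements of A (plus anything)  *)
(* for some k > 0. The other cases are now statements about exponents. Being  *)
(* of Borel type or strongly stable passes to all powers of I. Being          *)
(* lexsegment does not, but if k u is a sum of k elements of A and v >_lex u  *)
(* first differs from u at i, with the same degree, then the part of k v      *)
(* above the common initial segment can be distributed over the k summands    *)
(* so that each summand either is unchanged or increases lexicographically.   *)

Set Implicit Arguments.
Unset Strict Implicit.
Unset Printing Implicit Defensive.

Import GRing.Theory.
Local Open Scope classical_set_scope.
Local Open Scope ring_scope.

(** * Powers and integral closure of ideals in a commutative ring *)

(** A monomial ideal is [monomial_span A] for its exponent set [A], its powers are spanned by
    iterated sumsets ([monomial_span_exp]), and its closure is spanned by [integral_exponents A]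
    ([integral_closure_monomial_span]). A property inherited by every [sumset_exp A k] can be
    applied at the multiple [k u], and dividing by [k] returns to [u]; this settles Borel type and
    strong stability. Powers of a lexsegment ideal need not be lexsegment, so
    [lexsegment_sumset_exp] proves a weaker replacement, sufficient when comparing [k u] with [k v].
    Adding variables commutes with closure ([integral_exponents_restrict]), which reduces the
    universal case to the lexsegment one. Borel-fixedness needs no exponents: a ring endomorphism
    preserving an ideal preserves its closure ([integral_closure_rmorph]). *)

Section IdealPowers.
Variable R : comNzRingType.
Implicit Types (G I J L : set R) (x y : R).

Definition is_ideal J : Prop :=
  [/\ J 0, forall x y, J x -> J y -> J (x + y) & forall a x, J x -> J (a * x)].

Lemma ideal_gen_sub G x : G x -> ideal_gen G x.
Proof.
move=> Gx; exists [:: (1, x)]; last by rewrite big_seq1 mul1r.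
by move=> p; rewrite inE => /eqP ->.
Qed.

Lemma is_ideal_gen G : is_ideal (ideal_gen G).
Proof.
split=> [|_ _ [s Gs ->] [t Gt ->]|a _ [s Gs ->]].
- by exists [::] => //; rewrite big_nil.
- exists (s ++ t); last by rewrite big_cat.
  by move=> p; rewrite mem_cat => /orP[/Gs|/Gt].
- exists [seq (a * p.1, p.2) | p <- s].
    by move=> _ /mapP[p /Gs Gp ->].
  by rewrite big_map mulr_sumr; apply: eq_bigr => p _; rewrite mulrA.
Qed.

Lemma ideal_gen_min G J : is_ideal J -> G `<=` J -> ideal_gen G `<=` J.
Proof.
case=> J0 JD JM GJ _ [s Gs ->]; elim: s Gs => [|p s IHs] Gs.
  by rewrite big_nil.
rewrite big_cons; apply: JD; first by apply/JM/GJ/Gs; rewrite mem_head.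
by apply: IHs => q qs; apply: Gs; rewrite inE qs orbT.
Qed.

Lemma ideal_mulP I J L : is_ideal L ->
  (forall x y, I x -> J y -> L (x * y)) -> ideal_mul I J `<=` L.
Proof.
by move=> idL IJL; apply: ideal_gen_min => // _ [x Ix [y Jy <-]]; apply: IJL.
Qed.

Lemma ideal_mul_mem I J x y : I x -> J y -> ideal_mul I J (x * y).
Proof. by move=> Ix Jy; apply: ideal_gen_sub; exists x => //; exists y. Qed.

Lemma ideal_expS I k : ideal_exp I k.+1 = ideal_mul I (ideal_exp I k).
Proof. by []. Qed.

Lemma is_ideal_exp I k : is_ideal (ideal_exp I k).
Proof. by case: k => [|k]; [split | apply: is_ideal_gen]. Qed.

Lemma ideal_exp_mul I i j x y :
  ideal_exp I i x -> ideal_exp I j y -> ideal_exp I (i + j) (x * y).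
Proof.
move=> + Iy; elim: i x => [|i IHi] x Ix.
  by have [_ _] := is_ideal_exp I j; apply.
have [E0 ED EM] := is_ideal_exp I (i.+1 + j).
suff: ideal_exp I i.+1 `<=` [set x | ideal_exp I (i.+1 + j) (x * y)] by apply.
rewrite ideal_expS; apply: ideal_mulP; first split=> /=.
- by rewrite mul0r.
- by move=> u v Iu Iv; rewrite mulrDl; apply: ED.
- by move=> a u Iu; rewrite -mulrA; apply: EM.
- by move=> u v Iu Iv /=; rewrite -mulrA; apply/ideal_mul_mem/IHi.
Qed.

Lemma ideal_exp_mono I J k : I `<=` J -> ideal_exp I k `<=` ideal_exp J k.
Proof.
move=> IJ; elim: k => //= k IHk; apply: ideal_mulP; first exact: is_ideal_gen.
by move=> x y /IJ Jx /IHk Jy; apply: ideal_mul_mem.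
Qed.

Lemma ideal_exp_expr J x k : J x -> ideal_exp J k (x ^+ k).
Proof.
by move=> Jx; elim: k => //= k IHk; rewrite exprS; apply: ideal_mul_mem.
Qed.

(** Multiplying the equation of [x] by [a ^+ k] gives one for [a * x], with [c i] scaled by
    [a ^+ i]. *)
Lemma integral_closure_mull I a x :
  integral_closure I x -> integral_closure I (a * x).
Proof.
case=> k [c [k_gt0 Ic root_x]]; exists k, (fun i => c i * a ^+ i); split=> //.
  move=> i /Ic Ici; rewrite mulrC.
  by have [_ _] := is_ideal_exp I i; apply.
transitivity (a ^+ k * 0); last by rewrite mulr0.
rewrite -[X in _ = _ * X]root_x mulrDr mulr_sumr exprMn; congr (_ + _).
apply: eq_big_nat => i /andP[_ le_ik].
rewrite exprMn -{3}(subnKC (le_ik : (i <= k)%N)) exprD.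
by rewrite -!mulrA mulrCA; congr (_ * _); rewrite mulrCA.
Qed.

End IdealPowers.

Lemma ideal_exp_rmorph (R R' : comNzRingType) (phi : {rmorphism R -> R'})
    (I : set R) (I' : set R') k :
  I `<=` phi @^-1` I' -> ideal_exp I k `<=` phi @^-1` (ideal_exp I' k).
Proof.
move=> phiI; elim: k => //= k IHk; apply: ideal_mulP => /=.
  have [E0 ED EM] := is_ideal_gen [set a * b | a in I' & b in ideal_exp I' k].
  split=> [|x y Ix Iy|a x Ix]; rewrite /preimage /=.
  - by rewrite rmorph0.
  - by rewrite rmorphD; apply: ED.
  - by rewrite rmorphM; apply: EM.
move=> x y /phiI Ix /IHk Iy; rewrite /preimage /= rmorphM.
exact: ideal_mul_mem.
Qed.

Lemma integral_closure_rmorph (R R' : comNzRingType) (phi : {rmorphism R -> R'})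
    (I : set R) (I' : set R') :
  I `<=` phi @^-1` I' ->
  integral_closure I `<=` phi @^-1` (integral_closure I').
Proof.
move=> phiI x [k [c [k_gt0 Ic root_x]]]; exists k, (phi \o c); split=> //.
  by move=> i /Ic /(ideal_exp_rmorph phiI).
transitivity (phi 0); last exact: rmorph0.
rewrite -[X in _ = phi X]root_x rmorphD rmorphXn rmorph_sum; congr (_ + _).
by apply: eq_bigr => i _; rewrite rmorphM rmorphXn.
Qed.

(** * The integral closure is an ideal, through the Rees algebra *)

Section ReesAlgebra.
Variables (R : comNzRingType) (I : set R).

Definition rees : {pred {poly R}} :=
  fun p => `[< forall i, ideal_exp I i p`_i >].

Lemma reesP (p : {poly R}) :
  reflect (forall i, ideal_exp I i p`_i) (p \in rees).
Proof. exact: asboolP. Qed.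

Lemma rees_subring_closed : subring_closed rees.
Proof.
split=> [|p q /reesP Ip /reesP Iq|p q /reesP Ip /reesP Iq]; apply/reesP=> i;
  have [E0 ED EM] := is_ideal_exp I i.
- by rewrite coef1; case: i E0 {ED EM}.
- by rewrite coefB -mulN1r; apply: ED (Ip i) (EM _ _ (Iq i)).
- rewrite coefM; elim/big_ind: _ => // j _.
  by have := ideal_exp_mul (Ip j) (Iq (i - j)%N); rewrite subnKC ?leq_ord.
Qed.

HB.instance Definition _ := GRing.isSubringClosed.Build {poly R} rees
  rees_subring_closed.

Definition rees_alg := {p : {poly R} | p \in rees}.
HB.instance Definition _ := SubType.on rees_alg.
HB.instance Definition _ := Choice.on rees_alg.
HB.instance Definition _ := [SubChoice_isSubComNzRing of rees_alg by <:].

Let incl : {rmorphism rees_alg -> {poly R}} := val.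

(* [x] is integral over [I] iff [x T] is integral over the Rees algebra, the  *)
(* subring of polynomials in [T] whose [T^i]-coefficients lie in [I^i].       *)
Lemma integral_closure_rees x :
  integral_closure I x <-> integralOver incl (x *: 'X).
Proof.
split=> [[k [a [k_gt0 Ia root_x]]]|[p mon_p root_p]].
  (* The equation of [x] homogenised in [T]: [a i] carries [T^i], hence lies in the Rees algebra,
     and evaluating at [x T] gives the equation of [x] times [T^k]. *)
  pose q : {poly {poly R}} :=
    'X^k + \sum_(1 <= i < k.+1) (a i *: 'X^i)%:P * 'X^(k - i).
  have q_coef i : q`_i = (i == k)%:R
      + \sum_(1 <= j < k.+1) (a j *: 'X^j) * (i == (k - j)%N)%:R.
    rewrite /q coefD coefXn coef_sum; congr (_ + _).
    by apply: eq_bigr => j _; rewrite coefCM coefXn.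
  apply: (@integral_root_monic _ _ incl _ q).
  - rewrite monicE lead_coefDl ?lead_coefXn // size_polyXn ltnS.
    apply/leq_sizeP => i le_ki; rewrite coef_sum big_nat big1 //.
    move=> j /andP[j_gt0 _].
    rewrite coefCM coefXn; case: eqP => [i_eq|_]; last by rewrite mulr0.
    by move: le_ki; rewrite i_eq leqNgt ltn_subrL j_gt0 k_gt0.
  - rewrite /root /q hornerD hornerXn horner_sum exprZn.
    have -> : \sum_(1 <= i < k.+1) ((a i *: 'X^i)%:P * 'X^(k - i)).[x *: 'X] =
        (\sum_(1 <= i < k.+1) a i * x ^+ (k - i)) *: 'X^k :> {poly R}.
      rewrite scaler_suml !big_nat; apply: eq_bigr => i /andP[_ le_ik].
      rewrite hornerCM hornerXn exprZn -scalerAl -scalerAr -exprD subnKC //.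
      by rewrite scalerA.
    by rewrite -scalerDl root_x scale0r.
  - apply/integral_poly => i; rewrite q_coef big_nat.
    apply: integral_add; first exact: integral_nat.
    elim/big_ind: _ => [||j /Ia Iaj]; [exact: integral0 | exact: integral_add|].
    apply: integral_mul; last exact: integral_nat.
    have aj_rees : a j *: 'X^j \in rees.
      apply/reesP => l; rewrite coefZ coefXn.
      have [E0 _ _] := is_ideal_exp I l.
      by case: eqP => [->|_]; rewrite ?mulr1 ?mulr0.
    exact: (integral_id incl (exist (fun p => p \in rees) _ aj_rees : rees_alg)).
pose k := (size p).-1.
have size_p : size p = k.+1 by rewrite prednK // size_poly_gt0 monic_neq0.
have size_mp : size (map_poly incl p) = k.+1.
  by rewrite size_map_poly_id0 ?size_p // (monicP mon_p) rmorph1 oner_neq0.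
have pk1 : p`_k = 1 by apply/eqP; rewrite -monicE.
(* The [T^k]-coefficient of [p] at [x T] is the required equation: the term of index [j] contributes
   the [T^(k-j)]-coefficient of [p_j], an element of [I^(k-j)], times [x^j]. *)
move: root_p; rewrite /root horner_coef size_mp.
move=> /eqP/(congr1 (fun u : {poly R} => u`_k)).
rewrite coef0 coef_sum => root_p.
have {}root_p : \sum_(j < k.+1) (incl p`_j)`_(k - j) * x ^+ j = 0.
  rewrite -[RHS]root_p; apply: eq_bigr => j _; rewrite coef_map exprZn.
  by rewrite -scalerAr coefZ coefMXn ltnNge leq_ord /= mulrC.
have k_gt0 : (0 < k)%N.
  rewrite lt0n; apply/eqP => k0.
  have p0 : incl p`_0 = 1 by rewrite -k0 pk1 rmorph1.
  by move/eqP: root_p; rewrite k0 big_ord1 p0 coef1 expr0 mulr1 oner_eq0.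
exists k, (fun i => (incl p`_(k - i))`_i); split=> // [i _|].
  exact/(reesP _ (valP p`_(k - i))).
have inclpk : incl p`_k = 1 by rewrite pk1 rmorph1.
rewrite -[RHS]root_p big_ord_recr subnn inclpk coef1 mul1r addrC; congr (_ + _).
rewrite big_add1 /= big_nat_rev big_mkord; apply: eq_bigr => j _ /=.
by rewrite add0n subnSK // !subKn // ltnW.
Qed.

Lemma integral_closureB x y :
  integral_closure I x -> integral_closure I y -> integral_closure I (x - y).
Proof.
move=> /integral_closure_rees Ix /integral_closure_rees Iy.
by apply/integral_closure_rees; rewrite scalerBl; apply: integral_sub.
Qed.

Lemma is_ideal_integral_closure : is_ideal (integral_closure I).
Proof.
split=> [|x y Ix Iy|a x]; last exact: integral_closure_mull.
  exists 1%N, (fun=> 0); split=> // [i _|]; first by case: (is_ideal_exp I i).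
  by rewrite expr1 add0r big1 // => i _; rewrite mul0r.
rewrite -[y]opprK; apply: integral_closureB => //.
by rewrite -mulN1r; apply: integral_closure_mull.
Qed.

End ReesAlgebra.

(** * Monomial ideals and their exponents *)

Section Exponents.
Variable n : nat.
Implicit Types (A B : set 'X_{1..n}) (u v : 'X_{1..n}).

Definition upset A := forall u v, A u -> (u <= v)%MM -> A v.

Definition sumset A B : set 'X_{1..n} := [set (u + v)%MM | u in A & v in B].

(* Starting from [setT] adds an arbitrary exponent to the [k]-fold sums:      *)
(* these are the exponents of the k-th power of the monomial ideal of [A].    *)
Definition sumset_exp A (k : nat) : set 'X_{1..n} := iter k (sumset A) setT.

Definition integral_exponents A : set 'X_{1..n} :=
  [set u | exists2 k, (0 < k)%N & sumset_exp A k (u *+ k)%MM].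

Lemma subKm u v : (u <= v)%MM -> (u + (v - u))%MM = v.
Proof. by move=> uv; rewrite addmC submK. Qed.

Lemma lem_mulmn u v k : (u <= v)%MM -> (u *+ k <= v *+ k)%MM.
Proof.
by move=> /mnm_lepP uv; apply/mnm_lepP => i; rewrite !mulmnE leq_mul2r uv orbT.
Qed.

Lemma upsetT : upset setT. Proof. by []. Qed.

Lemma upset_sumset A B : upset B -> upset (sumset A B).
Proof.
move=> upB _ w [u Au [v Bv <-]] /mnm_lepP le_w; exists u => //.
exists (w - u)%MM.
  apply: upB Bv _; apply/mnm_lepP => i; rewrite mnmBE.
  by have := le_w i; rewrite mnmDE => /(leq_sub2r (u i)); rewrite addKn.
rewrite subKm //; apply/mnm_lepP => i; apply: leq_trans (le_w i).
by rewrite mnmDE leq_addr.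
Qed.

Lemma upset_sumset_exp A k : upset (sumset_exp A k).
Proof. by elim: k => [|k IHk]; [apply: upsetT | apply: upset_sumset]. Qed.

Lemma upset_integral_exponents A : upset (integral_exponents A).
Proof.
move=> u v [k k_gt0 Au] uv; exists k => //.
exact: upset_sumset_exp Au (lem_mulmn k uv).
Qed.

End Exponents.

(** * Monomial ideals as spans, and monomiality of the closure *)

Section MonomialSpan.
Variables (K : fieldType) (n : nat).
Implicit Types (A B : set 'X_{1..n}) (I J : set {mpoly K[n]}).
Implicit Types (u v m : 'X_{1..n}).

Definition monomial_span A : set {mpoly K[n]} :=
  [set f | forall m, m \in msupp f -> A m].

Lemma monomial_spanX A u : monomial_span A 'X_[u] <-> A u.
Proof.
split=> [Au|Au m]; last by rewrite msuppX inE => /eqP ->.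
by apply: Au; rewrite msuppX mem_head.
Qed.

Lemma is_ideal_monomial_span A : upset A -> is_ideal (monomial_span A).
Proof.
move=> upA; split=> [m|f g Af Ag m|a f Af m].
- by rewrite msupp0.
- by move/msuppD_le; rewrite mem_cat => /orP[/Af|/Ag].
- move/msuppM_le => /allpairsP[[u v] /= [_ /Af Av ->]].
  exact: upA Av (lem_addl _ _).
Qed.

Lemma monomial_span_sub A J :
  is_ideal J -> (forall m, A m -> J 'X_[m]) -> monomial_span A `<=` J.
Proof.
case=> J0 JD JM AJ f Af; rewrite [f]mpolyE big_seq.
elim/big_ind: _ => // m /Af Am; rewrite -mul_mpolyC.
exact/JM/AJ.
Qed.

Lemma monomial_span_ideal_gen A :
  upset A -> monomial_span A = ideal_gen [set 'X_[m] | m in A].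
Proof.
move=> upA; apply/seteqP; split.
  apply: monomial_span_sub; first exact: is_ideal_gen.
  by move=> m Am; apply: ideal_gen_sub; exists m.
apply: ideal_gen_min; first exact: is_ideal_monomial_span.
by move=> _ [m Am <-]; apply/monomial_spanX.
Qed.

Lemma monomial_ideal_span A : upset A -> monomial_ideal (monomial_span A).
Proof. by move=> /monomial_span_ideal_gen ->; exists A. Qed.

Lemma ideal_gen_monomials (M : set 'X_{1..n}) :
  ideal_gen [set 'X_[m] | m in M] =
  monomial_span [set u | exists2 m, M m & (m <= u)%MM].
Proof.
have upM : upset [set u | exists2 m, M m & (m <= u)%MM].
  by move=> u v [m Mm mu] uv; exists m => //; apply: lepm_trans mu uv.
apply/seteqP; split.
  apply: ideal_gen_min; first exact: is_ideal_monomial_span.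
  by move=> _ [m Mm <-]; apply/monomial_spanX; exists m => //; apply: lepm_refl.
have idM := is_ideal_gen [set 'X_[K, m] | m in M].
apply: monomial_span_sub => // u [m Mm mu].
rewrite -(submK mu) mpolyXD.
case: idM => _ _ IM.
by apply: (IM _ _ (ideal_gen_sub _)); exists m.
Qed.

Lemma monomial_idealP I :
  monomial_ideal I -> exists2 A, upset A & I = monomial_span A.
Proof.
case=> M ->; exists [set u | exists2 m, M m & (m <= u)%MM]; last first.
  exact: ideal_gen_monomials.
by move=> u v [m Mm mu] uv; exists m => //; apply: lepm_trans mu uv.
Qed.

Lemma monomial_spanM A B :
  upset A -> upset B ->
  ideal_mul (monomial_span A) (monomial_span B) = monomial_span (sumset A B).
Proof.
move=> upA upB; apply/seteqP; split.
  apply: ideal_mulP; first exact/is_ideal_monomial_span/upset_sumset.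
  move=> f g Af Bg m /msuppM_le/allpairsP[[u v] /= [/Af Au /Bg Bv ->]].
  by exists u => //; exists v.
apply: monomial_span_sub; first exact: is_ideal_gen.
move=> _ [u Au [v Bv <-]]; rewrite mpolyXD.
by apply: ideal_mul_mem => m; rewrite msuppX inE => /eqP ->.
Qed.

Lemma monomial_span_exp A k :
  upset A -> ideal_exp (monomial_span A) k = monomial_span (sumset_exp A k).
Proof.
move=> upA; elim: k => [|k IHk]; first by apply/seteqP; split.
by rewrite ideal_expS IHk monomial_spanM //; apply: upset_sumset_exp.
Qed.

Lemma integral_closureX A u :
  upset A -> integral_closure (monomial_span A) 'X_[u] <-> integral_exponents A u.
Proof.
move=> upA; split=> [[k [a [k_gt0 Ia root_u]]]|[k k_gt0 Au]].
  (* The monomial [u^k] must cancel in the equation, so some [a_i u^(k-i)] contains it, that is,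
     [a_i] contains [u^i]. *)
  move/(congr1 (mcoeff (u *+ k)%MM)): root_u.
  rewrite mcoeff0 mcoeffD mcoeffXn eqxx raddf_sum /= => root_u.
  have [i /andP[/andP[i_gt0 le_ik] nz_i]] :
      exists i, (0 < i <= k)%N && ((a i)@_(u *+ i)%MM != 0).
    apply: contrapT => no_i; move/eqP: root_u.
    rewrite big_nat big1 ?addr0 ?oner_eq0 //.
    move=> i lt_ik; have uE : (u *+ k = u *+ (k - i) + u *+ i)%MM.
      by apply/mnmP => j; rewrite mnmDE !mulmnE -mulnDr subnK //; case/andP: lt_ik.
    rewrite mpolyXn uE mcoeffMX; apply/eqP/negPn/negP => nz_i.
    by apply: no_i; exists i; rewrite lt_ik nz_i.
  exists i => //; have := Ia i; rewrite i_gt0 le_ik monomial_span_exp //.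
  by move/(_ isT _); apply; rewrite mcoeff_msupp.
(* Conversely, [u] is a root of [X^k - u^k]. *)
exists k, (fun i => if i == k then - 'X_[u *+ k] else 0); split=> //.
  move=> i _; rewrite monomial_span_exp //; case: eqP => [->|_] m.
    by rewrite (perm_mem (msuppN _)) msuppX inE => /eqP ->.
  by rewrite msupp0.
rewrite big_nat_recr //= eqxx subnn expr0 mulr1 big_nat big1 ?add0r.
  by rewrite mpolyXn subrr.
by move=> i /andP[_ lt_ik]; rewrite ltn_eqF ?mul0r.
Qed.

Definition scale_var (i : 'I_n) (t : K) : n.-tuple {mpoly K[n]} :=
  [tuple (if j == i then t else 1) *: 'X_j | j < n].

Lemma comp_scale_varX i t m :
  'X_[m] \mPo (scale_var i t) = t ^+ m i *: 'X_[m].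
Proof.
rewrite comp_mpolyX [in RHS]mpolyXE_id.
under eq_bigr => j _ do rewrite tnth_mktuple exprZn.
rewrite scaler_prod; congr (_ *: _).
rewrite (bigD1 i) //= eqxx big1 ?mulr1 // => j /negPf ->.
by rewrite expr1n.
Qed.

Lemma mcoeff_comp_scale_var i t f m :
  (f \mPo (scale_var i t))@_m = t ^+ m i * f@_m.
Proof.
rewrite comp_mpolyEX raddf_sum /= [in RHS](mpolyE f) raddf_sum mulr_sumr.
apply: eq_bigr => u _; rewrite comp_scale_varX /= !mcoeffZ mcoeffX.
by case: eqP => [->|_]; rewrite ?mulr0 //= !mulr1 mulrC.
Qed.

(** A nonzero polynomial [X^a - X^b] has finitely many roots; this is where the infinite field
    enters. *)
Lemma exists_expr_neq (a b : nat) :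
  infinite_set [set: K] -> a != b -> exists t : K, t ^+ a != t ^+ b.
Proof.
move=> K_inf neq_ab; apply: contrapT => all_eq.
pose p : {poly K} := 'X^a - 'X^b.
have p_neq0 : p != 0.
  apply/eqP => /(congr1 (fun q : {poly K} => q`_a)).
  rewrite coefB !coefXn eqxx (negPf neq_ab) coef0 subr0.
  by move/eqP; rewrite oner_eq0.
have [B _ sizeB] := infinite_set_fset (size p) K_inf.
have rootB : all (root p) (finmap.enum_fset B).
  apply/allP => t _; rewrite /root hornerD hornerN !hornerXn subr_eq0.
  by apply/negPn/negP => ?; apply: all_eq; exists t.
have := max_poly_roots p_neq0 rootB (finmap.fset_uniq B).
by rewrite ltnNge sizeB.
Qed.

(* Subtracting [t ^+ v i *: f] from the image of [f] under ['X_i |-> t 'X_i]  *)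
(* kills the monomial [v]; when [t ^+ u i != t ^+ v i], it keeps [u].         *)
Lemma torus_stable_msupp J :
    infinite_set [set: K] ->
    (forall f g, J f -> J g -> J (f - g)) -> (forall a f, J f -> J (a * f)) ->
    (forall i t f, J f -> J (f \mPo (scale_var i t))) ->
  forall f, J f -> forall u, u \in msupp f -> J 'X_[u].
Proof.
move=> K_inf JB JM J_torus f; have [N] := ubnP (size (msupp f)).
elim: N f => // N IHN f size_f Jf u fu.
have [all_u|/allPn[v fv neq_vu]] := boolP (all (pred1 u) (msupp f)).
  suff -> : 'X_[u] = (f@_u)^-1%:MP * f by apply: JM.
  apply/mpolyP => m; rewrite mcoeffCM mcoeffX; case: eqP => [<-|neq_um].
    by rewrite mulVf -?mcoeff_msupp.
  rewrite [f@_m]memN_msupp_eq0 ?mulr0 //; apply/negP => /(allP all_u) /eqP mu.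
  by rewrite mu in neq_um.
have [i neq_i] : exists i, u i != v i.
  apply: contrapT => eq_uv; case/eqP: neq_vu; apply/mnmP => i.
  by apply/eqP/negPn/negP => ne; apply: eq_uv; exists i; rewrite eq_sym.
have [t neq_t] := exists_expr_neq K_inf neq_i.
pose g := f \mPo (scale_var i t) - (t ^+ v i)%:MP * f.
have gE m : g@_m = (t ^+ m i - t ^+ v i) * f@_m.
  by rewrite mcoeffB mcoeff_comp_scale_var mcoeffCM mulrBl.
apply: (IHN g); last first.
- by rewrite mcoeff_msupp gE mulf_neq0 ?subr_eq0 -?mcoeff_msupp.
- by apply: JB; [apply: J_torus | apply: JM].
suff : (size (msupp g) < size (msupp f))%N by move/leq_trans; apply.
suff : (size (msupp g) <= size (rem v (msupp f)))%N.
  by rewrite size_rem //; case: (msupp f) fv.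
apply: uniq_leq_size => // m; rewrite mem_rem_uniq // !inE !mcoeff_msupp gE.
rewrite mulf_eq0 negb_or subr_eq0 => /andP[neq_tm ->]; rewrite andbT.
by apply: contraNneq neq_tm => ->.
Qed.

(** Rescaling a variable preserves the span, hence its closure; by [torus_stable_msupp] the closure
    then contains every monomial of its elements, and [integral_closureX] identifies these. *)
Lemma integral_closure_monomial_span A :
  infinite_set [set: K] -> upset A ->
  integral_closure (monomial_span A) = monomial_span (integral_exponents A).
Proof.
move=> K_inf upA; apply/seteqP; split=> [f If u fu|].
  pose J := integral_closure (monomial_span A).
  have J_torus i t g : J g -> J (g \mPo (scale_var i t)).
    apply: (@integral_closure_rmorph _ _ (comp_mpoly (scale_var i t))).
    move=> h Ah m.
    rewrite mcoeff_msupp mcoeff_comp_scale_var mulf_eq0 negb_or.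
    by case/andP => _; rewrite -mcoeff_msupp => /Ah.
  apply/(integral_closureX u upA).
  exact: (torus_stable_msupp K_inf (@integral_closureB _ _)
            (@integral_closure_mull _ _) J_torus If).
apply: monomial_span_sub; first exact: is_ideal_integral_closure.
by move=> m /integral_closureX; apply.
Qed.

End MonomialSpan.

(** * Ideals of Borel type *)

Section BorelType.
Variables (K : fieldType) (n : nat).
Implicit Types (A : set 'X_{1..n}) (P : pred 'I_n) (u v m : 'X_{1..n}).

(** Exponent form of the inclusion of [I : x_i^oo] in [I : x_j^oo]. *)
Definition transfer A (i j : 'I_n) : Prop :=
  forall m r, A (m + U_(i) *+ r)%MM -> exists s, A (m + U_(j) *+ s)%MM.

(** In each factor, the power of [x_i] is traded for a power of [x_j]. The parts free of [x_i]
    together divide [m], so the new product divides [m] times a power of [x_j]. *)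
Lemma transfer_sumset_exp A i j k :
  upset A -> transfer A i j -> transfer (sumset_exp A k) i j.
Proof.
move=> upA Aij; elim: k => [|k IHk] m r; first by exists 0%N.
case=> u Au [v Av uv_eq].
have split_i (w : 'X_{1..n}) :
    w = ([multinom if l == i then 0 else w l | l < n] + U_(i) *+ w i)%MM.
  apply/mnmP => l; rewrite mnmDE mulmnE mnm1E mnmE.
  by rewrite eq_sym; case: eqVneq => [->|_]; rewrite ?mul1n // addn0.
move: Au Av; rewrite (split_i u) (split_i v).
set u' := [multinom _ | _ < _]; set v' := [multinom _ | _ < _].
move=> /Aij[s Au] /IHk[t Av]; exists (s + t)%N.
apply: (@upset_sumset_exp _ A k.+1 ((u' + U_(j) *+ s) + (v' + U_(j) *+ t))%MM).
  by exists (u' + U_(j) *+ s)%MM => //; exists (v' + U_(j) *+ t)%MM.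
apply/mnm_lepP => l; have := congr1 (fun w : 'X_{1..n} => w l) uv_eq.
rewrite !mnmDE !mulmnE !mnm1E !mnmE mulnDr.
rewrite addnACA leq_add2r eq_sym; case: eqVneq => [//|_].
by rewrite addn0 => ->.
Qed.

Lemma transfer_integral_exponents A i j :
  upset A -> transfer A i j -> transfer (integral_exponents A) i j.
Proof.
move=> upA Aij m r [k k_gt0 Am].
have [s As] : exists s, sumset_exp A k (m *+ k + U_(j) *+ s)%MM.
  apply: (transfer_sumset_exp upA Aij (r := (r * k)%N)).
  congr (sumset_exp A k _): Am.
  by apply/mnmP => l; rewrite !(mnmDE, mulmnE) mulnDl mulnA.
exists s, k => //; apply: upset_sumset_exp As _; apply/mnm_lepP => l.
by rewrite !(mnmDE, mulmnE) mulnDl leq_add2l -mulnA leq_mul2l leq_pmulr ?orbT.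
Qed.

Lemma variable_ideal_exp P k (g : {mpoly K[n]}) u :
  ideal_exp (ideal_gen [set 'X_j | j in [set j | P j]]) k g ->
  u \in msupp g -> (k <= \sum_(j | P j) u j)%N.
Proof.
pose W k := [set u : 'X_{1..n} | (k <= \sum_(j | P j) u j)%N].
have upW d : upset (W d).
  move=> v w Wv /mnm_lepP le_vw; apply: leq_trans Wv _; exact: leq_sum.
suff: ideal_exp (ideal_gen [set 'X_j | j in [set j | P j]]) k `<=`
      monomial_span (K := K) (W k) by move=> sub /sub; apply.
have genW : ideal_gen [set 'X_j | j in [set j | P j]] `<=`
    monomial_span (K := K) (W 1%N).
  apply: ideal_gen_min; first exact: is_ideal_monomial_span.
  move=> _ [j Pj <-]; apply/monomial_spanX.
  by rewrite /W /= (bigD1 j) //= mnm1E eqxx.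
apply: subset_trans (ideal_exp_mono genW) _.
rewrite monomial_span_exp // => f Wf v /Wf {f Wf}.
elim: k v => //= k IHk _ [v Wv [w /IHk Ww <-]].
rewrite /W /=; under eq_bigr => j _ do rewrite mnmDE.
by rewrite big_split /= -add1n leq_add.
Qed.

Lemma uniform_bound (T : eqType) (s : seq T) (Q : T -> nat -> Prop) :
  (forall x p q, Q x p -> (p <= q)%N -> Q x q) ->
  (forall x, x \in s -> exists p, Q x p) ->
  exists p, forall x, x \in s -> Q x p.
Proof.
move=> Qmono; elim: s => [|x s IHs] Qs; first by exists 0%N.
have [|p Qp] := IHs; first by move=> y ys; apply: Qs; rewrite inE ys orbT.
have [q Qq] := Qs x (mem_head _ _).
exists (maxn p q) => y; rewrite inE => /orP[/eqP ->|/Qp Qy].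
  exact: Qmono Qq (leq_maxr _ _).
exact: Qmono Qy (leq_maxl _ _).
Qed.

Lemma ideal_saturation_anti (I L L' : set {mpoly K[n]}) :
  L `<=` L' -> ideal_saturation I L' `<=` ideal_saturation I L.
Proof.
move=> LL' f [r r_gt0 If]; exists r => // g Lg; apply: If.
exact: ideal_exp_mono LL' _ Lg.
Qed.

Lemma borel_type_transfer A :
  upset A ->
  borel_type (monomial_span (K := K) A) <->
  forall i j : 'I_n, (j <= i)%N -> transfer A i j.
Proof.
move=> upA; have set1E i :
    [set 'X_i] = [set ('X_j : {mpoly K[n]}) | j in [set j | j == i]].
  by apply/seteqP; split=> [_ ->|_ [j /eqP -> <-]] //; exists i => //=.
split=> [bI i j le_ji m r Am|Atr i].
  have : ideal_saturation (monomial_span (K := K) A)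
      (ideal_gen [set 'X_i]) 'X_[m].
    exists r.+1 => // g; rewrite set1E => Lg _
      /msuppM_le/allpairsP[[v w] /= [mv gw ->]].
    move: mv; rewrite msuppX inE => /eqP -> {v}.
    have := variable_ideal_exp Lg gw; rewrite big_pred1_eq => lt_rw.
    apply: upA Am _; apply/mnm_lepP => l; rewrite !mnmDE leq_add2l mulmnE mnm1E.
    by case: eqP => // <-; rewrite mul1n ltnW.
  rewrite bI => -[s s_gt0 Is]; exists s; apply/(monomial_spanX K).
  rewrite mpolyXD -mpolyXn; apply: Is; apply: ideal_exp_expr.
  by apply: ideal_gen_sub; exists j.
(* Saturating by the larger ideal gives the smaller result; only the other inclusion uses
   [transfer]. *)
apply/seteqP; split; last first.
  apply: ideal_saturation_anti; apply: ideal_gen_min; first exact: is_ideal_gen.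
  by move=> _ ->; apply: ideal_gen_sub; exists i => /=.
move=> f [r r_gt0 If].
have Ai m : m \in msupp f -> A (m + U_(i) *+ r)%MM.
  move=> fm.
  have /If : ideal_exp (ideal_gen [set 'X_i]) r ('X_i ^+ r : {mpoly K[n]}).
    exact/ideal_exp_expr/ideal_gen_sub.
  by apply; rewrite mpolyXn addmC mcoeff_msupp mcoeffMX -mcoeff_msupp.
have [R AR] : exists R, forall p,
    p \in [seq (m, j) | m <- msupp f, j <- enum 'I_n] ->
    (p.2 <= i)%N -> A (p.1 + U_(p.2) *+ R)%MM.
  apply: uniform_bound => [p q s Ap le_qs /Ap Aq|p].
    apply: upA Aq _; apply/mnm_lepP => l.
    by rewrite !mnmDE leq_add2l !mulmnE leq_mul2l le_qs orbT.
  move=> /allpairsP[[m j] /= [fm _ ->]] /=.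
  case: (leqP j i) => [le_ji|]; last by exists 0%N.
  by have [s As] := Atr i j le_ji _ _ (Ai m fm); exists s.
(* Pigeonhole: a monomial of degree above [n * R] in the [x_j] with [j <= i] is divisible by some
   [x_j^R], and [R] serves all monomials of [f] and all such [j] at once. *)
exists (n * R).+1 => // g Lg _ /msuppM_le/allpairsP[[m u] /= [fm gu ->]].
have [j le_ji le_Ru] : exists2 j : 'I_n, (j <= i)%N & (R <= u j)%N.
  apply: contrapT => no_j.
  have := variable_ideal_exp (P := fun j => (j <= i)%N) Lg gu.
  rewrite ltnNge => /negP; apply.
  rewrite -[X in (_ <= X * _)%N]card_ord -sum_nat_const.
  rewrite [X in (_ <= X)%N](bigID (fun j : 'I_n => (j <= i)%N)) /=.
  apply: leq_trans (leq_addr _ _); apply: leq_sum => j le_ji.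
  rewrite leqNgt; apply/negP => lt_Ru; apply: no_j; exists j => //.
  exact: ltnW.
apply: (upA (m + U_(j) *+ R)%MM).
  by apply: (AR (m, j)) => //; apply/allpairsP; exists (m, j); rewrite mem_enum.
apply/mnm_lepP => l; rewrite !mnmDE leq_add2l mulmnE mnm1E.
by case: eqP => // <-; rewrite mul1n.
Qed.

End BorelType.

(** * Strongly stable ideals *)

Section StronglyStable.
Variable n : nat.
Implicit Types (A : set 'X_{1..n}) (u v m : 'X_{1..n}).

Definition exchange A : Prop :=
  forall u (i j : 'I_n), A u -> (i < j)%N -> (U_(j) <= u)%MM ->
    A (U_(i) + (u - U_(j)))%MM.

(** If [x_j] divides a product, it divides one factor, and the exchange is made there. *)
Lemma exchange_sumset_exp A k : exchange A -> exchange (sumset_exp A k).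
Proof.
move=> exA; elim: k => // k IHk _ i j [u Au [v Av <-]] lt_ij.
have [u_j _|] := boolP (U_(j) <= u)%MM.
  exists (U_(i) + (u - U_(j)))%MM; first exact: exA.
  exists v => //; apply/mnmP => l; rewrite !(mnmDE, mnmBE).
  by rewrite -addnA addnBAC // (mnm_lepP u_j).
rewrite lep1mP negbK => u_j0.
rewrite lep1mP mnmDE (eqP u_j0) add0n -lep1mP => v_j.
exists u => //; exists (U_(i) + (v - U_(j)))%MM; first exact: IHk.
apply/mnmP => l; rewrite !(mnmDE, mnmBE) addnCA; congr (_ + _)%N.
by rewrite addnBA // (mnm_lepP v_j).
Qed.

Lemma exchange_integral_exponents A :
  exchange A -> exchange (integral_exponents A).
Proof.
move=> exA u i j [k k_gt0 Au] lt_ij u_j; exists k => //.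
(* Exchange one [x_j] at a time inside the [k]-th power; [p = k] gives the [k]-th power of the
   exchanged monomial. *)
suff moved p : (p <= k)%N ->
    sumset_exp A k (U_(i) *+ p + (u *+ k - U_(j) *+ p))%MM.
  congr (sumset_exp A k _): (moved k (leqnn k)).
  by apply/mnmP => l; rewrite !(mnmDE, mnmBE, mulmnE) mulnDl mulnBl.
elim: p => [_|p IHp lt_pk].
  congr (sumset_exp A k _): Au; apply/mnmP => l.
  by rewrite mnmDE mnmBE !mulmnE !muln0 subn0.
have /exchange_sumset_exp := exA; move/(_ k _ i j (IHp (ltnW lt_pk)) lt_ij).
(* Since [x_j] divides [u], there are at least [k > p] copies of it in [u^k], so the truncated
   subtractions are exact. *)
have u_jl l : (p.+1 * (j == l) <= u l * k)%N.
  have := mnm_lepP u_j l; rewrite mnm1E.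
  case: (j == l) => [u_l|]; last by rewrite muln0.
  by rewrite muln1 -[p.+1]mul1n leq_mul.
have Uj_le : (U_(j) <= U_(i) *+ p + (u *+ k - U_(j) *+ p))%MM.
  apply/mnm_lepP => l; have := u_jl l; rewrite !(mnmDE, mnmBE, mulmnE, mnm1E).
  by case: (j == l); lia.
move=> /(_ Uj_le) moved; congr (sumset_exp A k _): moved.
apply/mnmP => l; have := u_jl l; rewrite !(mnmDE, mnmBE, mulmnE, mnm1E).
by case: (i == l); case: (j == l); lia.
Qed.

End StronglyStable.

(** * Lexsegment ideals *)

Section Lexsegment.
Variable n : nat.
Implicit Types (A : set 'X_{1..n}) (u v m : 'X_{1..n}).

Definition lexsegment_set A : Prop :=
  forall u v, A u -> mdeg v = mdeg u -> lex_gt v u -> A v.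

Lemma exists_lem_mdeg m d :
  (d <= mdeg m)%N -> exists2 u, (u <= m)%MM & mdeg u = d.
Proof.
elim: d => [_|d IHd lt_dm].
  by exists 0%MM; [apply/mnm_lepP => i; rewrite mnm0E | apply: mdeg0].
have [u le_um deg_u] := IHd (ltnW lt_dm).
have [i lt_ui] : exists i, (u i < m i)%N.
  apply: contrapT => no_i; move: lt_dm; rewrite -deg_u ltnNge => /negP; apply.
  rewrite !mdegE; apply: leq_sum => i _; rewrite leqNgt; apply/negP => lt_i.
  by apply: no_i; exists i.
exists (u + U_(i))%MM; last by rewrite mdegD mdeg1 addn1 deg_u.
apply/mnm_lepP => j; rewrite mnmDE mnm1E.
by case: eqP => [<-|_]; rewrite ?addn1 // addn0 (mnm_lepP le_um).
Qed.

Variable i : 'I_n.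

(** The index [i], later the first place where two exponents differ, belongs to the head and not to
    the tail. *)
Definition mnm_head m := [multinom if (j <= i)%N then m j else 0%N | j < n].
Definition tail_deg m := (\sum_(j : 'I_n | (i < j)%N) m j)%N.

Lemma mnm_headD u v : mnm_head (u + v)%MM = (mnm_head u + mnm_head v)%MM.
Proof. by apply/mnmP => j; rewrite !(mnmDE, mnmE); case: ifP. Qed.

Lemma tail_degD u v : tail_deg (u + v)%MM = (tail_deg u + tail_deg v)%N.
Proof.
by rewrite /tail_deg -big_split; apply: eq_bigr => j _; rewrite mnmDE.
Qed.

Lemma mdeg_head_tail m : mdeg m = (mdeg (mnm_head m) + tail_deg m)%N.
Proof.
rewrite !mdegE /tail_deg [X in (_ + X)%N]big_mkcond -big_split.
apply: eq_bigr => j _; rewrite mnmE ltnNge.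
by case: (j <= i)%N; rewrite /= ?addn0.
Qed.

Lemma mnm_head_id m : tail_deg m = 0%N -> mnm_head m = m.
Proof.
move/eqP; rewrite sum_nat_eq0 => /forall_inP tail0; apply/mnmP => j.
by rewrite mnmE; case: leqP => // /tail0/eqP ->.
Qed.

(* In each summand of an element of [sumset_exp A k] that has a nonzero tail, *)
(* the lexsegment property lets us replace the tail by any exponent of the    *)
(* same degree that is nonzero at [i]; [q] counts these summands.             *)
Lemma lexsegment_sumset_exp A k m :
  lexsegment_set A -> sumset_exp A k m ->
  exists q, [/\ (q <= k)%N, (q <= tail_deg m)%N &
    forall t : 'X_{1..n}, (forall j : 'I_n, (j < i)%N -> t j = 0%N) ->
      mdeg t = tail_deg m -> (q <= t i)%N -> sumset_exp A k (mnm_head m + t)%MM].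
Proof.
move=> lexA; elim: k m => [|k IHk] m; first by exists 0%N; split.
case=> u Au [v /IHk[q [le_qk le_qv Av]] <-].
have le_u : ((0 < tail_deg u) <= tail_deg u)%N by case: tail_deg.
exists ((0 < tail_deg u) + q)%N; split.
- exact: (leq_add (leq_b1 _) le_qk).
- by rewrite tail_degD; apply: leq_add.
move=> t t0; rewrite tail_degD => deg_t le_ti.
pose p := ((0 < tail_deg u) + q)%N.
have Ui_t : (U_(i) *+ p <= t)%MM.
  apply/mnm_lepP => j; rewrite mulmnE mnm1E; case: eqP => // <-.
  by rewrite mul1n.
(* The share [t1] of [t] given to [u]: set [p] copies of [x_i] aside, take [s] from the rest, and
   give one copy back if [u] has a nonzero tail. The other [q] copies remain for [v]. *)
have [|s le_s deg_s] := @exists_lem_mdeg (t - U_(i) *+ p)%MM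
  (tail_deg u - (0 < tail_deg u)).
  have := congr1 mdeg (submK Ui_t); rewrite mdegD mdegMn mdeg1 mul1n deg_t /p.
  lia.
pose t1 := (s + U_(i) *+ (0 < tail_deg u))%MM.
have t1_i : ((0 < tail_deg u) <= t1 i)%N.
  by rewrite mnmDE mulmnE mnm1E eqxx mul1n leq_addl.
have deg_t1 : mdeg t1 = tail_deg u.
  by rewrite mdegD deg_s mdegMn mdeg1 mul1n subnK.
have le_t1 j : (t1 j + (i == j) * q <= t j)%N.
  have := mnm_lepP le_s j; have := mnm_lepP Ui_t j.
  rewrite !(mnmDE, mnmBE, mulmnE, mnm1E) /p; case: (i == j); lia.
clearbody t1; have t1_t : (t1 <= t)%MM.
  by apply/mnm_lepP => j; apply: leq_trans (le_t1 j); apply: leq_addr.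
have deg_t2 : mdeg (t - t1)%MM = tail_deg v.
  by have := congr1 mdeg (submK t1_t); rewrite mdegD deg_t deg_t1; lia.
exists (mnm_head u + t1)%MM; last first.
  exists (mnm_head v + (t - t1))%MM.
    apply: Av => // [j /t0 tj0|]; first by rewrite mnmBE tj0.
    by have := le_t1 i; rewrite eqxx mnmBE; lia.
  rewrite mnm_headD; apply/mnmP => j; rewrite !(mnmDE, mnmBE).
  by rewrite addnACA subnKC // (mnm_lepP t1_t).
(* With zero tail the summand is unchanged; otherwise [t1] vanishes before [i] and is positive at
   [i], so the new summand is lexicographically larger and of the same degree. *)
have [tail0|tail_gt0] := posnP (tail_deg u).
  have t10 : t1 = 0%MM by apply/eqP; rewrite -mdeg_eq0 deg_t1 tail0.
  by rewrite t10 addm0 mnm_head_id.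
apply: lexA Au _ _; first by rewrite mdegD deg_t1 -mdeg_head_tail.
exists i; split=> [j lt_ji|]; rewrite mnmDE mnmE.
  have := mnm_lepP t1_t j; rewrite t0 // leqn0 => /eqP ->.
  by rewrite ltnW // addn0.
by move: t1_i; rewrite leqnn tail_gt0 -addn1 leq_add2l.
Qed.

End Lexsegment.

Lemma lexsegment_integral_exponents n (A : set 'X_{1..n}) :
  lexsegment_set A -> lexsegment_set (integral_exponents A).
Proof.
move=> lexA u v [k k_gt0 Au] deg_v [i [eq_lt lt_i]]; exists k => //.
have [q [le_qk _ Aq]] := lexsegment_sumset_exp i lexA Au.
have head_v : (mnm_head i u <= v)%MM.
  apply/mnm_lepP => j; rewrite mnmE; case: ifP => //.
  by rewrite leq_eqVlt => /orP[/eqP/val_inj ->|/eq_lt ->]; first exact: ltnW.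
(* This [t] vanishes before [i] and is positive at [i], so [t *+ k] has the [q <= k] copies of [x_i]
   that [lexsegment_sumset_exp] asks for. *)
pose t := (v - mnm_head i u)%MM.
have deg_t : mdeg t = tail_deg i u.
  have := congr1 mdeg (subKm head_v).
  by rewrite mdegD deg_v (mdeg_head_tail i u) => /addnI.
have /Aq : forall j : 'I_n, (j < i)%N -> (t *+ k)%MM j = 0%N.
  by move=> j lt_ji; rewrite mulmnE mnmBE mnmE ltnW // eq_lt // subnn.
have tail_uk : tail_deg i (u *+ k)%MM = (tail_deg i u * k)%N.
  by rewrite /tail_deg big_distrl; apply: eq_bigr => j _; rewrite mulmnE.
rewrite mdegMn deg_t tail_uk => /(_ erefl).
have le_qt : (q <= (t *+ k)%MM i)%N.
  apply: leq_trans le_qk _; rewrite mulmnE leq_pmull // mnmBE mnmE leqnn.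
  by rewrite subn_gt0.
move=> /(_ le_qt) Avk; congr (sumset_exp A k _): Avk.
apply/mnmP => j; rewrite -[in RHS](subKm head_v) !(mnmDE, mulmnE) mulnDl.
by congr (_ + _)%N; rewrite !mnmE mulmnE; case: ifP.
Qed.

(** * Adding variables *)

Section Extension.
Variables (K : fieldType) (n r : nat).
Implicit Types (A : set 'X_{1..n}) (u v : 'X_{1..n}) (w : 'X_{1..n + r}).

Definition mnm_restrict w : 'X_{1..n} := [multinom w (lshift r i) | i < n].
Definition mnm_extend u : 'X_{1..n + r} :=
  [multinom if split j is inl i then u i else 0%N | j < n + r].

Lemma mnm_extend_lshift u i : mnm_extend u (lshift r i) = u i.
Proof. by rewrite mnmE (unsplitK (inl i)). Qed.

Lemma mnm_extend_rshift u i : mnm_extend u (rshift n i) = 0%N.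
Proof. by rewrite mnmE (unsplitK (inr i)). Qed.

Lemma mnm_extendK : cancel mnm_extend mnm_restrict.
Proof. by move=> u; apply/mnmP => i; rewrite mnmE mnm_extend_lshift. Qed.

Lemma mnm_extend_le u w : (mnm_extend u <= w)%MM = (u <= mnm_restrict w)%MM.
Proof.
apply/mnm_lepP/mnm_lepP => [le_uw i|le_uw j].
  by rewrite mnmE -mnm_extend_lshift.
case: (split_ordP j) => i ->; last by rewrite mnm_extend_rshift.
by rewrite mnm_extend_lshift; have := le_uw i; rewrite mnmE.
Qed.

Lemma mnm_restrictD w w' :
  mnm_restrict (w + w')%MM = (mnm_restrict w + mnm_restrict w')%MM.
Proof. by apply/mnmP => i; rewrite !(mnmDE, mnmE). Qed.

Lemma mnm_restrictMn w k : mnm_restrict (w *+ k)%MM = (mnm_restrict w *+ k)%MM.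
Proof. by apply/mnmP => i; rewrite !(mulmnE, mnmE). Qed.

Lemma upset_restrict A : upset A -> upset (mnm_restrict @^-1` A).
Proof.
move=> upA w w' Aw /mnm_lepP le_ww'; apply: upA Aw _.
by apply/mnm_lepP => i; rewrite !mnmE.
Qed.

Lemma sumset_exp_restrict A k :
  sumset_exp (mnm_restrict @^-1` A) k = mnm_restrict @^-1` (sumset_exp A k).
Proof.
apply/seteqP; split; elim: k => // k IHk w.
  case=> w1 Aw1 [w2 /IHk Aw2 <-]; exists (mnm_restrict w1) => //.
  by exists (mnm_restrict w2) => //; rewrite mnm_restrictD.
case=> u Au [v Av uv_eq].
have le_uw : (mnm_extend u <= w)%MM by rewrite mnm_extend_le -uv_eq lem_addr.
(* One factor is extended by zero; the remaining ones absorb all the new variables, ultimately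
   through the [setT] in [sumset_exp]. *)
exists (mnm_extend u); first by rewrite /preimage /= mnm_extendK.
exists (w - mnm_extend u)%MM; last exact: subKm.
apply: IHk; congr (sumset_exp A k _): Av.
apply: (@addmI _ u); rewrite uv_eq -[in LHS](subKm le_uw) mnm_restrictD.
by rewrite mnm_extendK.
Qed.

Lemma integral_exponents_restrict A :
  integral_exponents (mnm_restrict @^-1` A) =
  mnm_restrict @^-1` (integral_exponents A).
Proof.
apply/seteqP; split=> w [k k_gt0 Aw]; exists k => //.
  by move: Aw; rewrite sumset_exp_restrict /preimage /= mnm_restrictMn.
by rewrite sumset_exp_restrict /preimage /= mnm_restrictMn.
Qed.

Lemma comp_lshiftX u :
  'X_[K, u] \mPo [tuple 'X_(lshift r i) | i < n] = 'X_[mnm_extend u].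
Proof.
rewrite comp_mpolyX [RHS]mpolyXE_id big_split_ord /= [X in _ * X]big1 ?mulr1.
  by apply: eq_bigr => i _; rewrite tnth_mktuple mnm_extend_lshift.
by move=> i _; rewrite mnm_extend_rshift expr0.
Qed.

Lemma extended_monomial_span A :
  upset A ->
  extended_ideal r (monomial_span (K := K) A) =
  monomial_span (mnm_restrict @^-1` A).
Proof.
move=> upA; have idA := is_ideal_monomial_span K (upset_restrict upA).
apply/seteqP; split.
  apply: ideal_gen_min => // _ [f Af <-].
  rewrite comp_mpolyEX big_seq; have [A0 AD AM] := idA.
  elim/big_ind: _ => // u /Af Au; rewrite -mul_mpolyC; apply: AM.
  by rewrite comp_lshiftX; apply/monomial_spanX; rewrite /preimage /= mnm_extendK.
have [_ _ EM] := is_ideal_gen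
  [set f \mPo [tuple 'X_(lshift r i) | i < n] | f in monomial_span (K := K) A].
apply: monomial_span_sub; first exact: is_ideal_gen.
move=> w Aw; have le_w : (mnm_extend (mnm_restrict w) <= w)%MM.
  by rewrite mnm_extend_le lepm_refl.
rewrite -(submK le_w) mpolyXD -comp_lshiftX.
apply: (EM _ _ (ideal_gen_sub _)); exists 'X_[mnm_restrict w] => //.
exact/monomial_spanX.
Qed.

End Extension.

(** * Assembly of the five cases *)

Theorem theorem2p1 (K : fieldType) (n : nat) (I : set {mpoly K[n]})
  (K_infinite : infinite_set [set: K]) (I_monomial : monomial_ideal I) :
  [/\ borel_type I ->
        monomial_ideal (integral_closure I) /\ borel_type (integral_closure I),
      strongly_stable I ->
        monomial_ideal (integral_closure I) /\ strongly_stable (integral_closure I),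
      borel_fixed I ->
        monomial_ideal (integral_closure I) /\ borel_fixed (integral_closure I),
      lexsegment I ->
        monomial_ideal (integral_closure I) /\ lexsegment (integral_closure I)
    & universal_lexsegment I ->
        monomial_ideal (integral_closure I) /\
        universal_lexsegment (integral_closure I)].
Proof.
have [A upA ->] := monomial_idealP I_monomial.
have up_int := @upset_integral_exponents n A.
have int_fixed : borel_fixed (monomial_span (K := K) A) ->
    borel_fixed (integral_closure (monomial_span (K := K) A)).
  move=> fixA alpha unit_alpha trig_alpha f; rewrite /triangular_act.
  set lq := (X in comp_mpoly X).
  apply: (@integral_closure_rmorph _ _ (comp_mpoly lq)).
  exact: (fixA alpha unit_alpha trig_alpha).
have lex_span m (B : set 'X_{1..m}) :
    lexsegment (monomial_span (K := K) B) <-> lexsegment_set B.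
  split=> lexB u v.
    move=> Bu deg_v gt_v; apply/(monomial_spanX K); apply: (lexB u) => //.
    exact/monomial_spanX.
  by move=> /monomial_spanX Bu ? ?; apply/monomial_spanX; apply: (lexB u).
have mono_int := monomial_ideal_span K up_int.
rewrite integral_closure_monomial_span // in int_fixed *.
split=> [/borel_type_transfer Atr|sA|fixA|/lex_span lexA|lexA]; split=> //.
- apply/borel_type_transfer => // i j le_ji.
  exact/transfer_integral_exponents/Atr.
- move=> u i j /monomial_spanX Au lt_ij u_j; apply/monomial_spanX.
  apply: exchange_integral_exponents => // v k l Av lt_kl v_l.
  by apply/(monomial_spanX K); apply: sA => //; apply/monomial_spanX.
- exact: int_fixed.
- exact/lex_span/lexsegment_integral_exponents.
- move=> r; rewrite extended_monomial_span // -integral_exponents_restrict.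
  apply/lex_span/lexsegment_integral_exponents/(lex_span _ _).
  by rewrite -extended_monomial_span.
Qed.
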